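(* Let $\ell\in\mathbb{N}$ (a fixed positive integer). For each dimension $d$ let $\mathcal{C}^{\ell}_{\mathrm{opt}}(d)$ denote the optimal (i.e. largest possible) constant in the inequality $$ \sum_{n\in\mathbb{Z}^d}|\Delta^{\ell/2}u(n)|^2\;\ge\;\mathcal{C}^{\ell}_{\mathrm{opt}}(d)\sum_{n\in\mathbb{Z}^d}\frac{|u(n)|^2}{|n|^{2\ell}}\qquad\text{for all finitely supported } u \text{ on } \mathbb{Z}^d \text{ with } u(0)=0 . $$ Then $$ \lim_{d\to\infty}\frac{\mathcal{C}^{\ell}_{\mathrm{opt}}(d)}{d^{\ell}}=2^{\ell}. $$
   Context: Functions $u$ on $\mathbb{Z}^d$ are complex-valued; $|n|$ is the Euclidean norm of $n\in\mathbb{Z}^d$. Since $u(0)=0$, the term $n=0$ on the right-hand side is understood to be $0$. Let $e_j$ be the $j$-th standard basis vector of $\mathbb{R}^d$. The discrete gradient and (nonnegative) discrete Laplacian are $$\nabla u(n)=(\nabla_1u(n),\dots,\nabla_du(n)),\quad \nabla_ju(n)=u(n)-u(n-e_j),\qquad \Delta u(n)=\sum_{j=1}^d\big(2u(n)-u(n-e_j)-u(n+e_j)\big).$$ Powers of the Laplacian: $\Delta^{\ell/2}u:=\Delta^{k}u$ if $\ell=2k$ is even, and $\Delta^{\ell/2}u:=\nabla(\Delta^{k}u)$ if $\ell=2k+1$ is odd; in the odd case $|\cdot|$ on the left-hand side is the Euclidean norm on $\mathbb{C}^d$. *)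

(* Defs.v *)
From HB Require Import structures.
From mathcomp Require Import all_boot all_order all_algebra.
From mathcomp Require Import all_classical all_reals all_analysis.
From mathcomp Require Import complex.

Set Implicit Arguments.
Unset Strict Implicit.
Unset Printing Implicit Defensive.

Import Order.TTheory GRing.Theory Num.Theory.
Import numFieldNormedType.Exports.

Local Open Scope classical_set_scope.
Local Open Scope ring_scope.

Notation Zd d := 'rV[int]_d.

(* [ComplexField.Normc.normc] is the modulus with values in [R]; the generic
   norm of [R[i]] takes values in [R[i]]. *)
Notation cmod := ComplexField.Normc.normc.

Section DiscreteOperators.
Variables (R : realType) (d : nat).
Implicit Types (u : Zd d -> R[i]) (n : Zd d).

Definition basis_vec (j : 'I_d) : Zd d := delta_mx 0 j.

Definition grad u n : 'rV[R[i]]_d :=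
  \row_(j < d) (u n - u (n - basis_vec j)).

Definition lap u n : R[i] :=
  \sum_(j < d) (u n *+ 2 - u (n - basis_vec j) - u (n + basis_vec j)).

Definition lattice_norm n : R :=
  Num.sqrt (\sum_(j < d) ((n 0 j)%:~R : R) ^+ 2).

Definition euclid_norm (v : 'rV[R[i]]_d) : R :=
  Num.sqrt (\sum_(j < d) cmod (v 0 j) ^+ 2).

(* |Delta^{l/2} u(n)|: the modulus of Delta^k u(n) for l = 2k, the Euclidean
   norm in C^d of grad (Delta^k u)(n) for l = 2k+1. *)
Definition norm_lap_pow (l : nat) u n : R :=
  let v := iter l./2 lap u in
  if odd l then euclid_norm (grad v n) else cmod (v n).

(* The sums are over all of Z^d and are meant for u of finite support, for
   which both summands have finite support (see [finite_norm_lap_pow]). *)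
Definition energy (l : nat) u : R :=
  \sum_(n \in [set: Zd d]) norm_lap_pow l u n ^+ 2.

(* For u 0 = 0 the term n = 0 is 0. *)
Definition hardy_sum (l : nat) u : R :=
  \sum_(n \in [set: Zd d]) cmod (u n) ^+ 2 / lattice_norm n ^+ (2 * l).

Definition finitely_supported u := finite_set [set n | u n != 0].

Definition hardy_admissible (l : nat) : set R :=
  [set C | forall u, finitely_supported u -> u 0 = 0 ->
             C * hardy_sum l u <= energy l u].

(* The supremum is a maximum whenever d > 0, see [hardy_const_max]; in
   dimension 0 every constant is admissible and [sup] is a dummy value. *)
Definition hardy_const (l : nat) : R := sup (hardy_admissible l).

End DiscreteOperators.

Arguments hardy_admissible : clear implicits.
Arguments hardy_const : clear implicits.

Section Wellposedness.
Variables (R : realType) (d : nat).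
Implicit Types (u : Zd d -> R[i]).

Lemma finitely_supported_shift u (a : Zd d) :
  finitely_supported u -> finite_set [set n | u (n + a) != 0].
Proof.
move=> fu; apply: (@sub_finite_set _ _ ((fun m => m - a) @` [set n | u n != 0])).
  by move=> n /= un; exists (n + a) => //; rewrite addrK.
exact: finite_image.
Qed.

Lemma finite_lap u : finitely_supported u -> finitely_supported (lap u).
Proof.
move=> fu.
pose S : set (Zd d) := \bigcup_(j in [set: 'I_d])
  ([set n | u n != 0] `|` [set n | u (n - basis_vec j) != 0]
     `|` [set n | u (n + basis_vec j) != 0]).
apply: (@sub_finite_set _ _ S); last first.
  apply: bigcup_finite => // j _.
  by rewrite !finite_setU; split; [split|] => //; exact: finitely_supported_shift.
move=> n /= ln; apply: contrapT => nS; case/negP: ln; apply/eqP.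
apply: big1 => j _; move: nS; rewrite /S => nS.
have [a b c] : [/\ u n = 0, u (n - basis_vec j) = 0 & u (n + basis_vec j) = 0].
  split; apply/eqP/negPn/negP => h; apply: nS; exists j => //.
  - by left; left.
  - by left; right.
  - by right.
by rewrite a b c mul0rn !subr0.
Qed.

Lemma finite_norm_lap_pow l u : finitely_supported u ->
  finite_set [set n | norm_lap_pow l u n != 0].
Proof.
move=> fu; rewrite /norm_lap_pow; set v := iter _ _ _.
have {}fu : finitely_supported v.
  by rewrite /v; elim: (l./2) => //= k IH; exact: finite_lap.
case: (odd l).
  pose S : set (Zd d) := \bigcup_(j in [set: 'I_d])
    ([set n | v n != 0] `|` [set n | v (n - basis_vec j) != 0]).
  apply: (@sub_finite_set _ _ S); last first.
    apply: bigcup_finite => // j _.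
    by rewrite finite_setU; split => //; exact: finitely_supported_shift.
  move=> n /= ln; apply: contrapT => nS; case/negP: ln; apply/eqP.
  rewrite /euclid_norm big1 ?sqrtr0// => j _; rewrite mxE.
  have [a b] : [/\ v n = 0 & v (n - basis_vec j) = 0].
    split; apply/eqP/negPn/negP => h; apply: nS; exists j => //; by [left|right].
  by rewrite a b subrr ComplexField.Normc.normc0 expr0n.
apply: sub_finite_set fu => n /=; apply: contraNN => /eqP ->.
by rewrite ComplexField.Normc.normc0.
Qed.

Lemma energy_ge0 l u : 0 <= energy l u.
Proof. by apply: fsumr_ge0 => n _; exact: sqr_ge0. Qed.

Lemma hardy_const_max l : (0 < d)%N ->
  hardy_admissible R d l (hardy_const R d l) /\
  ubound (hardy_admissible R d l) (hardy_const R d l).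
Proof.
move=> d0; pose j0 := Ordinal d0.
have A0 : hardy_admissible R d l 0.
  by move=> u _ _; rewrite mul0r energy_ge0.
pose e : Zd d := basis_vec j0.
pose w : Zd d -> R[i] := fun n => if n == e then 1 else 0.
have e0 : e != 0.
  apply/eqP => /matrixP/(_ ord0 j0); rewrite /e /basis_vec !mxE !eqxx.
  exact/eqP/oner_neq0.
have fw : finitely_supported w.
  apply: (@sub_finite_set _ _ [set e]); last exact: finite_set1.
  by move=> n /=; rewrite /w; case: (eqVneq n e) => // _; rewrite eqxx.
have w0 : w 0 = 0 by rewrite /w eq_sym (negbTE e0).
have ne : lattice_norm R e = 1.
  rewrite /lattice_norm /e /basis_vec (bigD1 j0)//= big1 => [|j jj0].
    by rewrite !mxE !eqxx addr0 expr1n sqrtr1.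
  by rewrite !mxE (negbTE jj0) andbF expr0n.
have hw : hardy_sum l w = 1.
  rewrite /hardy_sum -(@fsbig_widen _ _ _ _ [set e]) //; last first.
    move=> n /= [_ /eqP/negbTE ne']; rewrite /w ne'.
    by rewrite ComplexField.Normc.normc0 expr0n mul0r.
  by rewrite fsbig_set1 /w eqxx ne ComplexField.Normc.normc1 !expr1n divr1.
have ub : has_ubound (hardy_admissible R d l).
  by exists (energy l w) => C /(_ w fw w0); rewrite hw mulr1.
split; last exact: ub_le_sup.
move=> u fu u0.
have [h|h|<-] := ltgtP 0 (hardy_sum l u).
- rewrite -ler_pdivlMr//; apply: ge_sup; first by exists 0.
  by move=> C /(_ u fu u0); rewrite ler_pdivlMr.
- suff: 0 <= hardy_sum l u by rewrite leNgt h.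
  apply: fsumr_ge0 => n _.
  by rewrite divr_ge0 ?sqr_ge0// exprn_ge0// sqrtr_ge0.
- by rewrite mulr0 energy_ge0.
Qed.

End Wellposedness.

(* Main.v *)
Require Import Defs.
From mathcomp Require Import all_boot all_order all_algebra.
From mathcomp Require Import all_classical all_reals all_analysis.
From mathcomp Require Import complex finmap ring lra.
Import Order.TTheory GRing.Theory Num.Theory.
Import numFieldNormedType.Exports.
Local Open Scope classical_set_scope.
Local Open Scope ring_scope.

Set Implicit Arguments.
Unset Strict Implicit.
Unset Printing Implicit Defensive.

(** Write D for the Laplacian, k = |n|^2, and let l be the order of the
inequality; the energy of u is then (D^l u, u).

Upper bound: test with the point mass at a basis vector e, whose Hardy sum is 1
because |e| = 1.  The Laplacian is 2d minus the adjacency operator.  Applied to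
a point mass, the adjacency operator gives a function bounded by 2 rather than
by 2d, so replacing D by 2d costs a relative error O(1/d) in supremum norm, and
D^l (point mass at e) has value at most (2d)^l (1 + O(1/d)) at e
([renergy_point_mass_le]).

Lower bound: everything rests on one family of positive supersolutions.  Fix a
real A >= 1, put q(n) = A + |n|^2 and W = 1 / q.  A step along an axis replaces
q by q + 1 + 2 n_j or q + 1 - 2 n_j, so D(W^p) / W^p is the sum over j of
2 - (q / (q + 1 + 2 n_j))^p - (q / (q + 1 - 2 n_j))^p.  Expanding the two terms
around q + 1, the contributions linear in n_j cancel and the quadratic ones add
up to O_p(|n|^2 / q^2) = O_p(1 / q), with no factor d; the main part
2d (1 - (q / (q + 1))^p) is at least 2d (A - 1/2) / q once p >= 2 A^2.  Hence
for d large (depending on A and p, but uniformly in n)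
  D(W^p) >= c W^(p+1),  with c = 2d (A - 1)       ([lap_weight_pow]).
At |n| = 1, c W is 2d (A - 1) / (A + 1), the sharp value 2d up to a factor that
tends to 1 with A; at n = 0 it stays below 2d, so the intermediate functions
D^i u, which do not vanish at the origin, cause no trouble.

A supersolution gives a Hardy inequality (ground state representation), and
using it for the two exponents p and p + m gives the weighted form
  (D f, W^m f) >= c sum W^(m+1) f^2               ([weighted_hardy]).
By Cauchy-Schwarz, sum W^a (D f)^2 >= c^2 sum W^(a+2) f^2
([weighted_rellich]).  Iterating this from a = 0 for even l, and from a = 1
after one Hardy inequality for odd l, gives
  energy >= c^l sum W^l u^2                       ([renergy_ge]).
Since W >= 1 / ((A + 1) k) for n <> 0, the optimal constant is at least
(2d)^l ((A - 1) / (A + 1))^l for large d ([hardy_const_ge]), and A is arbitrary.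

The operators have real coefficients, so the complex inequality is the sum of
the real ones for the real and imaginary parts ([energy_split]). *)

(** * Finitely supported sums over the lattice *)

Section LatticeSums.
Variables (R : realType) (d : nat).
Implicit Types (f g h : Zd d -> R) (n e : Zd d) (j : 'I_d).

Definition fin_supp f := finite_set [set n | f n != 0].

Definition zsum f : R := \sum_(n \in [set: Zd d]) f n.

Lemma fin_suppW f h :
  fin_supp f -> (forall n, f n = 0 -> h n = 0) -> fin_supp h.
Proof. by move=> ff fh; apply: sub_finite_set ff => n; apply/contra_neq/fh. Qed.

Lemma fin_suppU f g h : fin_supp f -> fin_supp g ->
  (forall n, f n = 0 -> g n = 0 -> h n = 0) -> fin_supp h.
Proof.
move=> ff fg fgh.
apply: (@sub_finite_set _ _ ([set n | f n != 0] `|` [set n | g n != 0])).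
  move=> n /= hn; have [fn|] := eqVneq (f n) 0; last by left.
  by right; apply: contra_neq hn; exact: fgh.
by rewrite finite_setU.
Qed.

Lemma fin_supp_shift f e : fin_supp f -> fin_supp (fun n => f (n + e)).
Proof.
move=> ff; apply: (@sub_finite_set _ _ ((fun m => m - e) @` [set n | f n != 0])).
  by move=> n /= fn; exists (n + e) => //; rewrite addrK.
exact: finite_image.
Qed.

Lemma fin_supp_sum (F : 'I_d -> Zd d -> R) :
  (forall j, fin_supp (F j)) -> fin_supp (fun n => \sum_j F j n).
Proof.
move=> fF; apply: (@sub_finite_set _ _
    (\bigcup_(j in [set: 'I_d]) [set n | F j n != 0])).
  move=> n /= Fn; apply: contrapT => nS; case/eqP: Fn; apply: big1 => j _.
  by apply/eqP/negPn/negP => Fjn; apply: nS; exists j.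
by apply: bigcup_finite => // j _; exact: fF.
Qed.

Lemma zsumE f (X : set (Zd d)) : finite_set X -> (forall n, f n != 0 -> X n) ->
  zsum f = \sum_(n <- fset_set X) f n.
Proof.
move=> fX fS; apply: fsbigTE => n; rewrite in_fset_set// => /negP nX.
by apply/eqP/negPn/negP => /fS/mem_set.
Qed.

Lemma zsumD f g : fin_supp f -> fin_supp g ->
  zsum (fun n => f n + g n) = zsum f + zsum g.
Proof.
move=> ff fg; pose X := [set n | f n != 0] `|` [set n | g n != 0].
have fX : finite_set X by rewrite finite_setU.
rewrite !(@zsumE _ X) ?big_split//.
- by move=> n ?; right.
- by move=> n ?; left.
move=> n fgn; apply: contrapT => /not_orP[/= /negP/negPn/eqP fn /negP/negPn/eqP gn].
by move: fgn; rewrite fn gn addr0 eqxx.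
Qed.

Lemma zsumZ a f : zsum (fun n => a * f n) = a * zsum f.
Proof. by rewrite /zsum mulr_fsumr. Qed.

Lemma eq_zsum f g : f =1 g -> zsum f = zsum g.
Proof. by move=> /funext ->. Qed.

Lemma zsumB f g : fin_supp f -> fin_supp g ->
  zsum (fun n => f n - g n) = zsum f - zsum g.
Proof.
move=> ff fg; rewrite zsumD//; last by apply: fin_suppW fg _ => n ->; rewrite oppr0.
by rewrite -mulN1r -zsumZ; congr (_ + _); apply: eq_zsum => n; rewrite mulN1r.
Qed.

Lemma zsum_ge0 f : (forall n, 0 <= f n) -> 0 <= zsum f.
Proof. by move=> f0; apply: fsumr_ge0 => n _. Qed.

Lemma zsum_shift f e : zsum (fun n => f (n + e)) = zsum f.
Proof.
rewrite /zsum [RHS](@reindex_fsbigT _ _ _ _ _ (fun n : Zd d => n + e))//.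
by exists (fun n => n - e) => n; rewrite (addrK, subrK).
Qed.

Lemma zsum_sum (F : 'I_d -> Zd d -> R) : (forall j, fin_supp (F j)) ->
  zsum (fun n => \sum_j F j n) = \sum_j zsum (F j).
Proof.
move=> fF; pose X := \bigcup_(j in [set: 'I_d]) [set n | F j n != 0].
have fX : finite_set X by apply: bigcup_finite => // j _; exact: fF.
rewrite (@zsumE _ X)//; last first.
  move=> n Fn; apply: contrapT => nS; case/eqP: Fn; apply: big1 => j _.
  by apply/eqP/negPn/negP => Fjn; apply: nS; exists j.
rewrite exchange_big/=; apply: eq_bigr => j _.
by rewrite (@zsumE _ X)// => n Fn; exists j.
Qed.

(** Discrete divergence theorem: it carries every summation by parts below. *)
Lemma zsum_divergence (T : 'I_d -> Zd d -> R) : (forall j, fin_supp (T j)) ->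
  zsum (fun n => \sum_j (T j n - T j (n + basis_vec j))) = 0.
Proof.
move=> fT; have fS j := fin_supp_shift (basis_vec j) (fT j).
rewrite zsum_sum => [|j].
  by apply: big1 => j _; rewrite zsumB// zsum_shift subrr.
by apply: fin_suppU (fT j) (fS j) _ => n -> ->; rewrite subrr.
Qed.

Lemma zsum_le f g : fin_supp f -> fin_supp g -> (forall n, f n <= g n) ->
  zsum f <= zsum g.
Proof.
move=> ff fg fg_le; rewrite -subr_ge0 -zsumB//.
by apply: zsum_ge0 => n; rewrite subr_ge0.
Qed.

(** The form in which identities between sums are proved: they reduce to a
pointwise identity once a flux [T] is exhibited. *)
Lemma zsum_eq_mod_divergence f g (T : 'I_d -> Zd d -> R) :
  fin_supp g -> (forall j, fin_supp (T j)) ->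
  (forall n, f n = g n + \sum_j (T j n - T j (n + basis_vec j))) ->
  zsum f = zsum g.
Proof.
move=> fg fT fE; rewrite (eq_zsum fE) zsumD//.
  by rewrite zsum_divergence// addr0.
apply: fin_supp_sum => j.
by apply: fin_suppU (fT j) (fin_supp_shift (basis_vec j) (fT j)) _ => n -> ->;
  rewrite subrr.
Qed.

(** * The real Laplacian and the ground state inequality *)

Definition rlap f n : R :=
  \sum_(j < d) (f n *+ 2 - f (n - basis_vec j) - f (n + basis_vec j)).

Lemma fin_supp_lap f : fin_supp f -> fin_supp (rlap f).
Proof.
move=> ff; apply: fin_supp_sum => j.
apply: fin_suppU (fin_supp_shift (- basis_vec j) ff)
  (fin_suppU ff (fin_supp_shift (basis_vec j) ff)
     (h := fun n => `|f n| + `|f (n + basis_vec j)|) _) _.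
  by move=> n -> ->; rewrite normr0 addr0.
move=> n -> /eqP; rewrite paddr_eq0// !normr_eq0 => /andP[/eqP-> /eqP->].
by rewrite mul0rn !subrr.
Qed.

(** Green's formula.  It is applied with [g] a power of the weight, whose
support is infinite; hence the finite support of [f] alone. *)
Lemma rlap_sym f g : fin_supp f ->
  zsum (fun n => f n * rlap g n) = zsum (fun n => g n * rlap f n).
Proof.
move=> ff.
pose T j n := f (n - basis_vec j) * g n - f n * g (n - basis_vec j).
apply: (zsum_eq_mod_divergence (T := T)).
- by apply: fin_suppW (fin_supp_lap ff) _ => n ->; rewrite mulr0.
- move=> j; apply: fin_suppU ff (fin_supp_shift (- basis_vec j) ff) _ => n.
  by rewrite /T => -> ->; rewrite !mul0r subrr.
move=> n; rewrite /rlap !mulr_sumr -big_split/=; apply: eq_bigr => j _.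
by rewrite /T addrK; ring.
Qed.

Lemma zsum_grad f : fin_supp f ->
  zsum (fun n => \sum_j (f n - f (n - basis_vec j)) ^+ 2) =
  zsum (fun n => f n * rlap f n).
Proof.
move=> ff.
pose T j n := f (n - basis_vec j) ^+ 2 - f n * f (n - basis_vec j).
apply: (zsum_eq_mod_divergence (T := T)).
- by apply: fin_suppW ff _ => n ->; rewrite mul0r.
- move=> j; apply: fin_suppU ff (fin_supp_shift (- basis_vec j) ff) _ => n.
  by rewrite /T => -> ->; rewrite !mul0r expr0n subrr.
move=> n; rewrite /rlap !mulr_sumr -big_split/=; apply: eq_bigr => j _.
by rewrite /T addrK; ring.
Qed.

(** The ground state representation before summation: with h = f^2 / phi,
2 f(n) f(m) <= h(n) phi(m) + phi(n) h(m) is the inequality of arithmetic and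
geometric means, applied to every neighbour m of n. *)
Lemma ground_state_le f h phi n :
  (forall m, 0 < phi m) -> (forall m, h m * phi m = f m ^+ 2) ->
  h n * rlap phi n + phi n * rlap h n <= 2 * (f n * rlap f n).
Proof.
move=> p0 hp; rewrite /rlap !mulr_sumr -big_split/=; apply: ler_sum => j _.
have hpn := hp n.
have key m : 2 * (f n * f m) <= h n * phi m + phi n * h m.
  have hE k : h k = f k ^+ 2 / phi k by rewrite -hp mulfK// gt_eqF.
  have p0n := p0 n; have p0m := p0 m.
  rewrite !hE -subr_ge0.
  have -> : f n ^+ 2 / phi n * phi m + phi n * (f m ^+ 2 / phi m)
       - 2 * (f n * f m)
     = (f n * phi m - f m * phi n) ^+ 2 / (phi n * phi m).
    by field; rewrite !gt_eqF.
  by rewrite divr_ge0 ?sqr_ge0// mulr_ge0// ltW.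
have := key (n - basis_vec j); have := key (n + basis_vec j).
set a := f (n - _); set b := f (n + _); set a' := phi (n - _).
set b' := phi (n + _); set a'' := h (n - _); set b'' := h (n + _).
move=> k1 k2.
have -> : h n * (phi n *+ 2 - a' - b') + phi n * (h n *+ 2 - a'' - b'')
  = 4 * f n ^+ 2 - (h n * a' + phi n * a'') - (h n * b' + phi n * b'').
  by rewrite -hpn; ring.
have -> : 2 * (f n * (f n *+ 2 - a - b)) =
   4 * f n ^+ 2 - 2 * (f n * a) - 2 * (f n * b) by ring.
lra.
Qed.

End LatticeSums.

(** * Powers of the weight are supersolutions in high dimension *)

Section PowerSupersolutions.
Variable R : realType.

(** By induction on [p], multiplying by (1 + z)^-1 <= 1 - z + 4 z^2.  The
constant [10 ^+ p] only has to satisfy C(p+1) >= 6 C(p) + 5 p + 4.  The bound on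
[z ^+ 2] keeps 1 + z away from 0. *)
Lemma inv_pow_taylor_le (p : nat) (z : R) : z ^+ 2 <= 2^-1 ->
  (1 + z)^-1 ^+ p <= 1 - p%:R * z + 10 ^+ p * z ^+ 2.
Proof.
move=> z2; have z4 : 4^-1 <= 1 + z by have := sqr_ge0 (z + 3 / 4); lra.
have z1 : z <= 1 by have := sqr_ge0 (z - 1); lra.
have zm1 : -1 <= z by lra.
have zp : 0 < 1 + z by lra.
have inv_le : (1 + z)^-1 <= 1 - z + 4 * z ^+ 2.
  rewrite -[_^-1]div1r ler_pdivrMr//.
  rewrite -subr_ge0 (_ : _ - 1 = z ^+ 2 * (3 + 4 * z)); last by ring.
  by rewrite mulr_ge0 ?sqr_ge0//; lra.
elim: p => [|p IH]; first by rewrite mul0r expr0; have := sqr_ge0 z; lra.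
rewrite exprS.
have i0 : 0 <= (1 + z)^-1 by rewrite invr_ge0 ltW.
apply: le_trans (ler_pM i0 (exprn_ge0 p i0) inv_le IH) _.
have p0 : (0:R) <= p%:R by [].
have C1 : p%:R + 1 <= 10 ^+ p :> R.
  rewrite -natrX -[1]/(1%:R) -natrD ler_nat addn1; exact: ltn_expl.
rewrite [10 ^+ p.+1]exprS -[p.+1%:R]natr1; move: (10 ^+ p) (p%:R) p0 C1 => C P P0 C1.
set y := z ^+ 2 in z2 *.
have y0 : 0 <= y by exact: sqr_ge0.
have y1 : y <= 1 by lra.
have zy : z * y <= y by rewrite ler_piMl.
have zy' : - y <= z * y by rewrite -mulN1r ler_wpM2r.
have yy : y * y <= y by rewrite ler_piMl.
have -> : (1 - z + 4 * y) * (1 - P * z + C * y) =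
  1 - (P + 1) * z + (4 + P + C) * y - (4 * P + C) * (z * y) + 4 * C * (y * y).
  by rewrite /y; ring.
have : (4 * P + C) * (- y) <= (4 * P + C) * (z * y).
  by rewrite ler_wpM2l//; lra.
have : 4 * C * (y * y) <= 4 * C * y by rewrite ler_wpM2l//; lra.
nra.
Qed.

(** Here q = A + |n|^2 and x is a coordinate of n.  With z = 2x / (q + 1), the
two terms are (q + 1)^-p (1 + z)^-p and (q + 1)^-p (1 - z)^-p; the linear terms
of the two expansions cancel.  The hypotheses give z^2 <= 1/2, because
(q + 1)^2 - 8 (q - 1) = (q - 3)^2. *)
Lemma sum_shifted_pow_le (p : nat) (q x : R) : 1 <= q -> x ^+ 2 <= q - 1 ->
  (q + 1 - 2 * x)^-1 ^+ p + (q + 1 + 2 * x)^-1 ^+ p <=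
  q^-1 ^+ p * (2 * (q / (q + 1)) ^+ p + 8 * 10 ^+ p * (x ^+ 2 / q ^+ 2)).
Proof.
move=> q1 xq; pose z := 2 * x / (q + 1).
have qp : 0 < q by lra.
have q1p : 0 < q + 1 by lra.
have z2 : z ^+ 2 <= 2^-1.
  rewrite /z expr_div_n ler_pdivrMr ?exprn_gt0//.
  have := sqr_ge0 (q - 3); nra.
have zN2 : (- z) ^+ 2 <= 2^-1 by rewrite sqrrN.
have T1 := inv_pow_taylor_le p z2; have T2 := inv_pow_taylor_le p zN2.
have E1 : (q + 1 + 2 * x)^-1 = (q + 1)^-1 * (1 + z)^-1.
  by rewrite -invfM mulrDr mulr1 /z [_ * (_ / _)]mulrC divfK// gt_eqF.
have E2 : (q + 1 - 2 * x)^-1 = (q + 1)^-1 * (1 + - z)^-1.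
  by rewrite -invfM mulrDr mulr1 /z mulrN [_ * (_ / _)]mulrC divfK// gt_eqF.
rewrite E1 E2 ![((q + 1)^-1 * _) ^+ p]exprMn -mulrDr.
rewrite (_ : q^-1 ^+ p = (q + 1)^-1 ^+ p * ((q + 1) / q) ^+ p); last first.
  by rewrite -exprMn mulrA mulVf ?gt_eqF// mul1r.
rewrite -mulrA ler_wpM2l//; first by rewrite exprn_ge0// invr_ge0 ltW.
rewrite mulrDr [X in _ <= X + _]mulrCA -exprMn.
rewrite (_ : (q + 1) / q * (q / (q + 1)) = 1); last first.
  by field; rewrite !gt_eqF.
rewrite expr1n mulr1.
have : 2 * 10 ^+ p * z ^+ 2 <=
    ((q + 1) / q) ^+ p * (8 * 10 ^+ p * (x ^+ 2 / q ^+ 2)).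
  apply: (@le_trans _ _ (8 * 10 ^+ p * (x ^+ 2 / q ^+ 2))); last first.
    apply: ler_peMl; last by rewrite exprn_ege1// ler_pdivlMr//; lra.
    by rewrite mulr_ge0 ?divr_ge0 ?sqr_ge0// mulr_ge0 ?exprn_ge0.
  have -> : 2 * 10 ^+ p * z ^+ 2 = 8 * 10 ^+ p * (x ^+ 2 / (q + 1) ^+ 2).
    by rewrite /z expr_div_n exprMn; ring.
  rewrite ler_wpM2l ?mulr_ge0 ?exprn_ge0//= ler_wpM2l ?sqr_ge0//=.
  by rewrite lef_pV2 ?posrE ?exprn_gt0// lerXn2r ?nnegrE//; lra.
move: T1 T2; rewrite sqrrN; lra.
Qed.

(** Bernoulli gives (q / (q + 1))^p <= q / (p + q), and what remains,
p / (p + q) >= (A - 1/2) / q, says that q (A - 1/2) <= p (q - A + 1/2); this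
follows from q <= 2 A (q - A + 1/2) and p >= 2 A^2. *)
Lemma one_sub_ratio_pow_ge (p : nat) (A q : R) : 1 <= A -> A <= q ->
  2 * A ^+ 2 <= p%:R -> (A - 2^-1) / q <= 1 - (q / (q + 1)) ^+ p.
Proof.
move=> A1 Aq Ap; have qp : 0 < q by lra.
have bern : 1 + p%:R / q <= (1 + q^-1) ^+ p.
  elim: p {Ap} => [|p IH]; first by rewrite mul0r addr0 expr0.
  rewrite exprS -natr1.
  have qi : 0 <= q^-1 by rewrite invr_ge0 ltW.
  have : (1 + q^-1) * (1 + p%:R / q) <= (1 + q^-1) * (1 + q^-1) ^+ p.
    by rewrite ler_wpM2l//; lra.
  apply: le_trans; have : 0 <= p%:R * q^-1 ^+ 2 by rewrite mulr_ge0// sqr_ge0.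
  rewrite expr2; nra.
rewrite (_ : q / (q + 1) = (1 + q^-1)^-1); last by field; rewrite !gt_eqF//; lra.
have p0 : (0:R) <= p%:R by [].
apply: (@le_trans _ _ (1 - (1 + p%:R / q)^-1)); last first.
  rewrite lerB// exprVn lef_pV2// posrE.
    by rewrite exprn_gt0// addr_gt0// invr_gt0.
  by rewrite ltr_wpDr// divr_ge0// ltW.
rewrite (_ : 1 - _ = p%:R / (p%:R + q)); last first.
  by field; rewrite !gt_eqF// addrC ltr_wpDr.
rewrite ler_pdivlMr ?ltr_wpDl// mulrAC ler_pdivrMr//.
have A0 : 0 < A by lra.
have h1 : q <= 2 * A * (q - A + 2^-1) by nra.
have h2 : 2 * A ^+ 2 * (q - A + 2^-1) <= p%:R * (q - A + 2^-1).
  by rewrite ler_wpM2r//; lra.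
have h3 : A * q <= A * (2 * A * (q - A + 2^-1)) by rewrite ler_wpM2l// ltW.
move: h2 h3; rewrite expr2; nra.
Qed.

Variable d : nat.
Implicit Types (n : Zd d) (A : R).

Definition reg_sqnorm A n : R := A + \sum_j ((n 0 j)%:~R) ^+ 2.

Definition weight A n : R := (reg_sqnorm A n)^-1.

Lemma reg_sqnorm_ge A n : A <= reg_sqnorm A n.
Proof. by rewrite lerDl sumr_ge0// => j _; exact: sqr_ge0. Qed.

Lemma coord_sqr_le A n j : (n 0 j)%:~R ^+ 2 <= reg_sqnorm A n - A.
Proof.
rewrite addrAC subrr add0r (bigD1 j)//= lerDl.
by rewrite sumr_ge0// => i _; exact: sqr_ge0.
Qed.

Lemma reg_sqnormD A n j :
  reg_sqnorm A (n + basis_vec j) = reg_sqnorm A n + 1 + 2 * (n 0 j)%:~R.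
Proof.
rewrite /reg_sqnorm (bigD1 j)//= [in RHS](bigD1 j)//= !mxE !eqxx/=.
rewrite (eq_bigr (fun i => (n 0 i)%:~R ^+ 2)) => [|i /negbTE ij].
  by rewrite intrD; ring.
by rewrite !mxE eqxx ij/= addr0.
Qed.

Lemma reg_sqnormB A n j :
  reg_sqnorm A (n - basis_vec j) = reg_sqnorm A n + 1 - 2 * (n 0 j)%:~R.
Proof.
rewrite -[in RHS](subrK (basis_vec j) n) reg_sqnormD !mxE !eqxx/= intrD.
by ring.
Qed.

Lemma weight_gt0 A n : 1 <= A -> 0 < weight A n.
Proof. by move=> A1; rewrite invr_gt0; have := reg_sqnorm_ge A n; lra. Qed.

(** The key estimate.  The gap between A - 1/2 and A - 1 pays d / q for the
quadratic error, which is at most 8 * 10^p (q - A) / q^2 after summing over the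
coordinates; hence the condition on [d], which is uniform in [n]. *)
Lemma lap_weight_pow (p : nat) A n : 1 <= A -> 2 * A ^+ 2 <= p%:R ->
  8 * 10 ^+ p <= d%:R :> R ->
  2 * d%:R * (A - 1) * weight A n ^+ p.+1 <= rlap (fun m => weight A m ^+ p) n.
Proof.
move=> A1 Ap dp; rewrite /rlap /weight; set q := reg_sqnorm A n.
have Aq : A <= q := reg_sqnorm_ge A n.
have q1 : 1 <= q by lra.
have qp : 0 < q by lra.
pose r := (q / (q + 1)) ^+ p.
pose S := \sum_(j < d) (2 - 2 * r - 8 * 10 ^+ p * ((n 0 j)%:~R ^+ 2 / q ^+ 2)).
apply: (@le_trans _ _ (q^-1 ^+ p * S)); last first.
  rewrite /S mulr_sumr; apply: ler_sum => j _.
  have xq : (n 0 j)%:~R ^+ 2 <= q - 1.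
    by have := @coord_sqr_le A n j; rewrite -/q; lra.
  have := sum_shifted_pow_le p q1 xq; rewrite -reg_sqnormB -reg_sqnormD -/r.
  set a := (_ : R)^-1 ^+ p; set b := (reg_sqnorm A (n + _))^-1 ^+ p.
  by nra.
have -> : S = 2 * d%:R * (1 - r) - 8 * 10 ^+ p * ((q - A) / q ^+ 2).
  rewrite /S (eq_bigr (fun j => 2 - 2 * r
      + - (8 * 10 ^+ p / q ^+ 2) * (n 0 j)%:~R ^+ 2)) => [|j _]; last by ring.
  rewrite big_split/= sumr_const card_ord -mulr_sumr -[_ *+ d]mulr_natr.
  have -> : q - A = \sum_j (n 0 j)%:~R ^+ 2 by rewrite /q /reg_sqnorm addrC addKr.
  by ring.
have r_le := one_sub_ratio_pow_ge A1 Aq Ap; rewrite -/r in r_le.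
rewrite exprS mulrA [X in X <= _]mulrC ler_wpM2l//; first by rewrite exprn_ge0// invr_ge0 ltW.
have d0 : (0:R) <= d%:R by [].
have h1 : 2 * d%:R * ((A - 2^-1) / q) <= 2 * d%:R * (1 - r).
  by rewrite ler_wpM2l// mulr_ge0.
have h2 : 8 * 10 ^+ p * ((q - A) / q ^+ 2) <= d%:R * q^-1.
  apply: ler_pM => //.
    by rewrite divr_ge0 ?sqr_ge0// subr_ge0.
  by rewrite ler_pdivrMr ?exprn_gt0// expr2 mulrA mulVf ?gt_eqF// mul1r; lra.
nra.
Qed.

End PowerSupersolutions.

(** * Weighted Hardy and Rellich inequalities *)

Section HardyChain.
Variables (R : realType) (d : nat).
Implicit Types (f g h : Zd d -> R) (n : Zd d).

Section Step.
Variables (A : R) (P p : nat).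
Hypotheses (A1 : 1 <= A) (Ap : 2 * A ^+ 2 <= p%:R).
Hypothesis dP : 8 * 10 ^+ P <= d%:R :> R.

(* The dimension is taken large for the exponent P, and the supersolution
   property is then available for every exponent between p and P. *)
Let c : R := 2 * d%:R * (A - 1).

Let c_ge0 : 0 <= c.
Proof. by rewrite /c mulr_ge0 ?mulr_ge0// subr_ge0. Qed.

Let supersolution (k : nat) n : (p <= k <= P)%N ->
  c * weight A n ^+ k.+1 <= rlap (fun m => weight A m ^+ k) n.
Proof.
move=> /andP[pk kP]; apply: lap_weight_pow => //.
  by rewrite (le_trans Ap)// ler_nat.
by apply: le_trans dP; rewrite ler_wpM2l// ler_weXn2l// ler1n.
Qed.

(** Multiply the ground state inequality for phi = W^p by W^m and sum.  Green's
formula turns W^(p+m) D h into h D(W^(p+m)), so that twice the right-hand side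
is bounded below by two terms, one for each of the supersolutions W^p and
W^(p+m). *)
Lemma weighted_hardy (m : nat) f : (p + m <= P)%N -> fin_supp f ->
  c * zsum (fun n => weight A n ^+ m.+1 * f n ^+ 2) <=
  zsum (fun n => weight A n ^+ m * (f n * rlap f n)).
Proof.
move=> pmP ff; pose W := @weight R d A.
have W0 n : 0 < W n := weight_gt0 n A1.
have Wp0 k n : 0 < W n ^+ k by rewrite exprn_gt0.
pose h n := f n ^+ 2 / W n ^+ p.
have hW n : h n * W n ^+ p = f n ^+ 2 by rewrite /h divfK// gt_eqF.
have h0 n : 0 <= h n by rewrite /h divr_ge0 ?sqr_ge0// ltW.
have fh : fin_supp h by apply: fin_suppW ff _ => n; rewrite /h => ->; rewrite expr0n mul0r.
pose phi n := W n ^+ p; pose psi n := W n ^+ (p + m).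
have fphi : fin_supp (fun n => W n ^+ m * (h n * rlap phi n)).
  by apply: fin_suppW fh _ => n ->; rewrite mul0r mulr0.
have fpsi : fin_supp (fun n => h n * rlap psi n).
  by apply: fin_suppW fh _ => n ->; rewrite mul0r.
have flh : fin_supp (fun n => psi n * rlap h n).
  by apply: fin_suppW (fin_supp_lap fh) _ => n ->; rewrite mulr0.
have fW : fin_supp (fun n => W n ^+ m.+1 * f n ^+ 2).
  by apply: fin_suppW ff _ => n ->; rewrite expr0n mulr0.
have fWl : fin_supp (fun n => W n ^+ m * (f n * rlap f n)).
  by apply: fin_suppW ff _ => n ->; rewrite mul0r mulr0.
(* Monotonicity of sums, applied to each of the two supersolution terms. *)
have sum_le g : fin_supp g -> (forall n, c * (W n ^+ m.+1 * f n ^+ 2) <= g n) ->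
    c * zsum (fun n => W n ^+ m.+1 * f n ^+ 2) <= zsum g.
  move=> fg le_g; rewrite -zsumZ; apply: zsum_le => //.
  by apply: fin_suppW fW _ => n ->; rewrite mulr0.
have phi_le := sum_le _ fphi _; have psi_le := sum_le _ fpsi _.
have {}phi_le : c * zsum (fun n => W n ^+ m.+1 * f n ^+ 2) <=
    zsum (fun n => W n ^+ m * (h n * rlap phi n)).
  apply: phi_le => n; rewrite -hW.
  have -> : c * (W n ^+ m.+1 * (h n * W n ^+ p)) =
      W n ^+ m * (h n * (c * W n ^+ p.+1)) by rewrite !exprS; ring.
  rewrite ler_wpM2l ?(ltW (Wp0 _ _))// ler_wpM2l//.
  by apply: supersolution; rewrite leqnn (leq_trans _ pmP)// leq_addr.
have {}psi_le : c * zsum (fun n => W n ^+ m.+1 * f n ^+ 2) <=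
    zsum (fun n => h n * rlap psi n).
  apply: psi_le => n; rewrite -hW.
  have -> : c * (W n ^+ m.+1 * (h n * W n ^+ p)) =
      h n * (c * W n ^+ (p + m).+1) by rewrite !exprS exprD; ring.
  by rewrite ler_wpM2l// supersolution// pmP leq_addr.
have : zsum (fun n => W n ^+ m * (h n * rlap phi n) + psi n * rlap h n) <=
    zsum (fun n => 2 * (W n ^+ m * (f n * rlap f n))).
  apply: zsum_le => [||n].
  - by apply: fin_suppU fphi flh _ => n -> ->; rewrite addr0.
  - by apply: fin_suppW fWl _ => n ->; rewrite mulr0.
  have := ground_state_le n (fun k => Wp0 p k) hW.
  rewrite -(ler_pM2l (Wp0 m n)); congr (_ <= _).
    by rewrite mulrDr /psi addnC exprD mulrA -/(phi n); ring.
  by ring.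
rewrite zsumD// zsumZ -rlap_sym//.
rewrite -/W; lra.
Qed.

(** Cauchy-Schwarz in the weighted Hardy inequality with m = a + 1, in the form
2 c W^(a+1) f D f <= c^2 W^(a+2) f^2 + W^a (D f)^2. *)
Lemma weighted_rellich (a : nat) f : (p + a.+1 <= P)%N -> fin_supp f ->
  c ^+ 2 * zsum (fun n => weight A n ^+ a.+2 * f n ^+ 2) <=
  zsum (fun n => weight A n ^+ a * rlap f n ^+ 2).
Proof.
move=> paP ff; pose W := @weight R d A; have flf := fin_supp_lap ff.
have W0 n : 0 < W n := weight_gt0 n A1.
pose X n := W n ^+ a.+2 * f n ^+ 2; pose Y n := W n ^+ a * rlap f n ^+ 2.
pose Z n := W n ^+ a.+1 * (f n * rlap f n).
have fX : fin_supp (fun n => c ^+ 2 * X n).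
  by apply: fin_suppW ff _ => n; rewrite /X => ->; rewrite expr0n !mulr0.
have fY : fin_supp Y.
  by apply: fin_suppW flf _ => n; rewrite /Y => ->; rewrite expr0n !mulr0.
have fZ : fin_supp (fun n => 2 * c * Z n).
  by apply: fin_suppW ff _ => n; rewrite /Z => ->; rewrite mul0r !mulr0.
have hardy : c * zsum X <= zsum Z := weighted_hardy paP ff.
have : zsum (fun n => 2 * c * Z n) <= zsum (fun n => c ^+ 2 * X n + Y n).
  apply: zsum_le => // [|n].
    by apply: fin_suppU fX fY _ => n -> ->; rewrite addr0.
  rewrite -subr_ge0 /X /Y /Z !exprS.
  have -> : c * (c * c ^+ 0) * (W n * (W n * W n ^+ a) * (f n * (f n * f n ^+ 0)))
      + W n ^+ a * (rlap f n * (rlap f n * rlap f n ^+ 0))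
      - 2 * c * (W n * W n ^+ a * (f n * rlap f n))
    = W n ^+ a * (c * W n * f n - rlap f n) ^+ 2 by ring.
  by rewrite mulr_ge0 ?sqr_ge0// exprn_ge0// ltW.
rewrite zsumD// !zsumZ -/X -/Y.
have := c_ge0; move: hardy; move: (zsum X) (zsum Y) (zsum Z) => x y z.
rewrite expr2; nra.
Qed.

Lemma weighted_rellich_iter (k a : nat) f : (p + (a + k.*2) <= P)%N -> fin_supp f ->
  c ^+ k.*2 * zsum (fun n => weight A n ^+ (a + k.*2) * f n ^+ 2) <=
  zsum (fun n => weight A n ^+ a * iter k (@rlap R d) f n ^+ 2).
Proof.
elim: k a => [|k IH] a akP ff; first by rewrite addn0 expr0 mul1r.
have fk : fin_supp (iter k (@rlap R d) f).
  by elim: {akP IH} k => //= k; exact: fin_supp_lap.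
apply: (le_trans _ (weighted_rellich _ fk)); last first.
  by apply: leq_trans akP; rewrite leq_add2l -addn1 leq_add2l.
have aE : (a + k.+1.*2 = a.+2 + k.*2)%N by rewrite doubleS !addnS !addSn.
rewrite aE -[k.+1.*2]/(2 + k.*2)%N exprD -mulrA ler_wpM2l ?sqr_ge0//.
by apply: IH => //; rewrite -aE.
Qed.

End Step.

End HardyChain.

(** * Energies of real functions *)

Section Energies.
Variables (R : realType) (d : nat).
Implicit Types (f g : Zd d -> R) (u : Zd d -> R[i]) (n : Zd d).

Definition renergy (l : nat) f : R :=
  let v := iter l./2 (@rlap R d) f in
  if odd l then zsum (fun n => \sum_j (v n - v (n - basis_vec j)) ^+ 2)
  else zsum (fun n => v n ^+ 2).

Lemma fin_supp_iter_lap (k : nat) f : fin_supp f -> fin_supp (iter k (@rlap R d) f).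
Proof. by move=> ff; elim: k => //= k; exact: fin_supp_lap. Qed.

Lemma cmod_sqr (z : R[i]) : cmod z ^+ 2 = complex.Re z ^+ 2 + complex.Im z ^+ 2.
Proof. by case: z => a b; rewrite /= sqr_sqrtr// addr_ge0// sqr_ge0. Qed.

Lemma Re_iter_lap (k : nat) u n :
  complex.Re (iter k (@lap R d) u n) = iter k (@rlap R d) (fun m => complex.Re (u m)) n.
Proof.
elim: k n => //= k IH n; rewrite /lap /rlap raddf_sum; apply: eq_bigr => j _.
by rewrite !raddfB raddfMn/= !IH.
Qed.

Lemma Im_iter_lap (k : nat) u n :
  complex.Im (iter k (@lap R d) u n) = iter k (@rlap R d) (fun m => complex.Im (u m)) n.
Proof.
elim: k n => //= k IH n; rewrite /lap /rlap raddf_sum; apply: eq_bigr => j _.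
by rewrite !raddfB raddfMn/= !IH.
Qed.

Lemma fin_supp_Re u : finitely_supported u -> fin_supp (fun n => complex.Re (u n)).
Proof. by apply: sub_finite_set => n; apply: contra_neq => ->. Qed.

Lemma fin_supp_Im u : finitely_supported u -> fin_supp (fun n => complex.Im (u n)).
Proof. by apply: sub_finite_set => n; apply: contra_neq => ->. Qed.

Lemma energy_split (l : nat) u : finitely_supported u ->
  energy l u = renergy l (fun n => complex.Re (u n)) + renergy l (fun n => complex.Im (u n)).
Proof.
move=> fu; pose v := iter l./2 (@lap R d) u.
pose a := iter l./2 (@rlap R d) (fun n => complex.Re (u n)).
pose b := iter l./2 (@rlap R d) (fun n => complex.Im (u n)).
have fa : fin_supp a := fin_supp_iter_lap _ (fin_supp_Re fu).
have fb : fin_supp b := fin_supp_iter_lap _ (fin_supp_Im fu).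
have fgrad f : fin_supp f ->
    fin_supp (fun n => \sum_j (f n - f (n - basis_vec j)) ^+ 2).
  move=> ff; apply: fin_supp_sum => j.
  apply: fin_suppU ff (fin_supp_shift (- basis_vec j) ff) _ => n -> ->.
  by rewrite subrr expr0n.
have fsqr f : fin_supp f -> fin_supp (fun n => f n ^+ 2).
  by move=> ff; apply: fin_suppW ff _ => n ->; rewrite expr0n.
rewrite /energy /renergy -/a -/b -/(zsum _) /norm_lap_pow -/v.
case: (odd l); rewrite -zsumD; try exact: fgrad; try exact: fsqr;
  apply: eq_zsum => n.
  rewrite /euclid_norm sqr_sqrtr; last by apply: sumr_ge0 => j _; exact: sqr_ge0.
  rewrite -big_split; apply: eq_bigr => j _.
  by rewrite mxE cmod_sqr !raddfB/= !Re_iter_lap !Im_iter_lap.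
by rewrite cmod_sqr Re_iter_lap Im_iter_lap.
Qed.

Lemma renergy_ge (A : R) (P p l : nat) f :
  1 <= A -> 2 * A ^+ 2 <= p%:R -> 8 * 10 ^+ P <= d%:R :> R -> (p + l <= P)%N ->
  fin_supp f ->
  (2 * d%:R * (A - 1)) ^+ l * zsum (fun n => weight A n ^+ l * f n ^+ 2) <=
  renergy l f.
Proof.
move=> A1 Ap dP plP ff; rewrite /renergy; set v := iter _ _ _.
have fv : fin_supp v := fin_supp_iter_lap _ ff.
have := odd_double_half l; case: (odd l) => /= lE.
  rewrite zsum_grad//.
  have p1P : (p + 0 <= P)%N by rewrite addn0 (leq_trans _ plP)// leq_addr.
  have := weighted_hardy A1 Ap dP p1P fv.
  under [X in _ <= X -> _]eq_zsum => n do rewrite expr0 mul1r.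
  apply: le_trans; rewrite -lE addnC exprD expr1 -mulrA mulrCA ler_wpM2l//.
    by rewrite mulr_ge0 ?mulr_ge0// subr_ge0.
  rewrite addnC; apply: (weighted_rellich_iter A1 Ap dP _ ff).
  by rewrite lE.
rewrite add0n in lE.
apply: (le_trans (y := zsum (fun n => weight A n ^+ 0 * v n ^+ 2))); last first.
  by under eq_zsum => n do rewrite expr0 mul1r.
rewrite -{1 2}lE -[l./2.*2]add0n.
apply: (weighted_rellich_iter A1 Ap dP _ ff); by rewrite add0n lE.
Qed.

(** Self-adjointness lets the energy of a point mass be read off from a single
value of the iterated Laplacian. *)
Lemma renergyE (l : nat) f : fin_supp f ->
  renergy l f = zsum (fun n => f n * iter l (@rlap R d) f n).
Proof.
move=> ff.
have sym (k m : nat) :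
    zsum (fun n => iter k (@rlap R d) f n * iter m (@rlap R d) f n) =
    zsum (fun n => f n * iter (k + m) (@rlap R d) f n).
  elim: k m => [//|k IH] m; rewrite addSnnS -IH [RHS]rlap_sym//=.
    by apply: eq_zsum => n; rewrite mulrC.
  exact: fin_supp_iter_lap.
rewrite -{2}(odd_double_half l) -addnn addnA -sym /renergy.
case: (odd l) => /=; last by apply: eq_zsum => n; rewrite expr2.
rewrite zsum_grad; last exact: fin_supp_iter_lap.
by apply: eq_zsum => n; rewrite mulrC.
Qed.

End Energies.

(** * The energy of a point mass *)

Section PointMass.
Variables (R : realType) (d : nat) (e : Zd d).
Implicit Types (f g : Zd d -> R) (n : Zd d).

Definition point_mass n : R := (n == e)%:R.

Lemma zsum_point_mass g : zsum (fun n => point_mass n * g n) = g e.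
Proof.
rewrite /zsum -(@fsbig_widen _ _ _ _ [set e]) //.
  by rewrite fsbig_set1 /point_mass eqxx mul1r.
by move=> n /= [_ /eqP/negbTE ne]; rewrite /point_mass ne mul0r.
Qed.

Lemma fin_supp_point_mass : fin_supp point_mass.
Proof.
apply: (@sub_finite_set _ _ [set e]); last exact: finite_set1.
by move=> n /=; rewrite /point_mass; case: (eqVneq n e); rewrite ?eqxx.
Qed.

Lemma basis_vec_inj : injective (@basis_vec d).
Proof.
move=> i j /matrixP/(_ 0 i)/eqP; rewrite /basis_vec !mxE !eqxx/=.
by case: (eqVneq i j).
Qed.

Lemma sum_point_mass_le (h : 'I_d -> Zd d) : injective h ->
  \sum_j point_mass (h j) <= 1.
Proof.
move=> hI; rewrite /point_mass.
have [j hj|nh] := pickP (fun j => h j == e).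
  rewrite (bigD1 j)//= hj big1 ?addr0// => i ij.
  by rewrite -(eqP hj) (inj_eq hI) (negbTE ij).
by rewrite big1// => j _; rewrite nh.
Qed.

Lemma norm_lap_le f (C : R) n :
  (forall m, `|f m| <= C) -> `|rlap f n| <= 4 * d%:R * C.
Proof.
move=> fC; apply: le_trans (ler_norm_sum _ _ _) _.
apply: (@le_trans _ _ (\sum_(j < d) 4 * C)); last first.
  by rewrite sumr_const card_ord -[_ *+ d]mulr_natr; lra.
apply: ler_sum => j _; have := fC n.
have := fC (n - basis_vec j); have := fC (n + basis_vec j).
rewrite !ler_norml; lra.
Qed.

(** With r_l the difference on the left, r_(l+1) = D r_l - (2d)^l s, where s
sums the point mass over the neighbours of n: D has norm at most 4d in supremum
norm and 0 <= s <= 2.  The constant T(l) = 2^(l+1) - 2 solves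
T(l+1) = 2 T(l) + 2. *)
Lemma iter_lap_point_mass (l : nat) n :
  2 * d%:R * `|iter l (@rlap R d) point_mass n - (2 * d%:R) ^+ l * point_mass n| <=
  (2 ^+ l.+1 - 2) * (2 * d%:R) ^+ l.
Proof.
have T0 k : 0 <= 2 ^+ k.+1 - 2 :> R.
  by rewrite subr_ge0 exprS ler_peMr// exprn_ege1// ler1n.
have [d0|d0] := posnP d.
  by rewrite {1}d0 mulr0 mul0r mulr_ge0// exprn_ge0// mulr_ge0.
have D0 : 0 < d%:R :> R by rewrite ltr0n.
elim: l n => [|l IH] n.
  by rewrite /= expr0 mul1r subrr normr0 mulr0 expr1 subrr mul0r.
pose r m := iter l (@rlap R d) point_mass m - (2 * d%:R) ^+ l * point_mass m.
pose s := \sum_j point_mass (n - basis_vec j) + \sum_j point_mass (n + basis_vec j).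
have -> : iter l.+1 (@rlap R d) point_mass n - (2 * d%:R) ^+ l.+1 * point_mass n
    = rlap r n - (2 * d%:R) ^+ l * s.
  have -> : rlap r n = iter l.+1 (@rlap R d) point_mass n
      - (2 * d%:R) ^+ l * rlap point_mass n.
    by rewrite /= /rlap mulr_sumr -sumrB; apply: eq_bigr => j _; rewrite /r; ring.
  have -> : rlap point_mass n = 2 * d%:R * point_mass n - s.
    rewrite /rlap /s !big_split/= !sumrN sumr_const card_ord.
    by rewrite -[_ *+ d]mulr_natr; ring.
  by rewrite exprS; ring.
have s0 : 0 <= s by rewrite addr_ge0// sumr_ge0// => j _; rewrite ler0n.
have s2 : s <= 2.
  rewrite -[2]/(1 + 1) lerD// sum_point_mass_le// => i j.
    by move=> /addrI/oppr_inj/basis_vec_inj.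
  by move=> /addrI/basis_vec_inj.
have r_le m : `|r m| <= (2 ^+ l.+1 - 2) * (2 * d%:R) ^+ l / (2 * d%:R).
  by rewrite ler_pdivlMr ?mulr_gt0// mulrC; exact: IH.
have := norm_lap_le n r_le.
have M0 : 0 <= (2 * d%:R) ^+ l :> R by rewrite exprn_ge0// mulr_ge0.
set M := (2 * d%:R) ^+ l in M0 *; set T := _ - 2.
have -> : 4 * d%:R * (T * M / (2 * d%:R)) = 2 * (T * M) by field; rewrite gt_eqF.
move=> rl.
have sM : `|M * s| <= 2 * M by rewrite ger0_norm ?mulr_ge0// mulrC ler_wpM2r.
have : `|rlap r n - M * s| <= 2 * (T * M) + 2 * M.
  by apply: le_trans (ler_normB _ _) _; exact: lerD.
rewrite -(ler_pM2l (mulr_gt0 (ltr0n R 2) D0)); move/le_trans; apply.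
rewrite [2 ^+ l.+2]exprS [_ ^+ l.+1 as X in _ <= _ * X]exprS -/M.
have -> : (2 * 2 ^+ l.+1 - 2) * (2 * d%:R * M) =
  2 * d%:R * (2 * (T * M) + 2 * M) by rewrite /T; ring.
by [].
Qed.

Lemma renergy_point_mass_le (l : nat) : (0 < d)%N ->
  renergy l point_mass <= (2 * d%:R) ^+ l * (1 + 2 ^+ l / d%:R).
Proof.
move=> d0; have D0 : 0 < d%:R :> R by rewrite ltr0n.
rewrite renergyE; last exact: fin_supp_point_mass.
rewrite zsum_point_mass; have := iter_lap_point_mass l e.
rewrite {2}/point_mass eqxx mulr1.
set x := iter _ _ _ _; have M0 : 0 <= (2 * d%:R) ^+ l :> R by rewrite exprn_ge0// mulr_ge0.
move: M0; set M := (2 * d%:R) ^+ l => M0; rewrite exprS => h.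
have : x - M <= 2 ^+ l * M / d%:R.
  rewrite ler_pdivlMr//; have := ler_norm (x - M).
  rewrite -(ler_pM2l D0); lra.
have -> : 2 ^+ l * M / d%:R = M * (2 ^+ l / d%:R) by ring.
lra.
Qed.

End PointMass.

(** * Bounds on the optimal constant *)

Section Bounds.
Variables (R : realType) (d l : nat).
Hypothesis d_gt0 : (0 < d)%N.

Lemma hardy_const_le :
  hardy_const R d l <= (2 * d%:R) ^+ l * (1 + 2 ^+ l / d%:R).
Proof.
pose e : Zd d := basis_vec (Ordinal d_gt0).
pose u n : R[i] := (point_mass R e n)%:C%C.
have fu : finitely_supported u.
  apply: sub_finite_set (fin_supp_point_mass R e) => n /=.
  by apply: contra_neq => p0; rewrite /u p0.
have e0 : 0 != e.
  rewrite eq_sym; apply/eqP => /matrixP/(_ ord0 (Ordinal d_gt0)).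
  by rewrite /e /basis_vec !mxE !eqxx; exact/eqP/oner_neq0.
have u0 : u 0 = 0 by rewrite /u /point_mass (negbTE e0).
have ne : lattice_norm R e = 1.
  rewrite /lattice_norm /e /basis_vec (bigD1 (Ordinal d_gt0))//= big1 => [|j jj0].
    by rewrite !mxE !eqxx addr0 expr1n sqrtr1.
  by rewrite !mxE (negbTE jj0) andbF expr0n.
have hu : hardy_sum l u = 1.
  rewrite /hardy_sum -[RHS](_ : zsum (fun n =>
    point_mass R e n * (lattice_norm R n ^+ (2 * l))^-1) = 1); last first.
    by rewrite zsum_point_mass ne expr1n invr1.
  apply: eq_zsum => n; rewrite cmod_sqr /= expr0n addr0 /point_mass.
  by case: (n == e); rewrite ?expr1n ?expr0n.
have [/(_ u fu u0) + _] := hardy_const_max R l d_gt0.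
rewrite hu mulr1 energy_split//= => /le_trans; apply.
rewrite [X in _ + X]renergyE; last first.
  by apply: sub_finite_set (finite_set0 _) => n /=; rewrite eqxx.
rewrite [zsum _](_ : _ = 0) ?addr0; first exact: renergy_point_mass_le.
by rewrite /zsum fsbig1// => n _; rewrite mul0r.
Qed.

(** For n <> 0 this is A + k <= (A + 1) k with the integer k = |n|^2 >= 1. *)
Lemma inv_lattice_norm_le (A : R) (n : Zd d) : 1 <= A -> n != 0 ->
  (lattice_norm R n ^+ (2 * l))^-1 <= ((A + 1) * weight A n) ^+ l.
Proof.
move=> A1 n0; rewrite exprM /lattice_norm sqr_sqrtr; last first.
  by apply: sumr_ge0 => j _; exact: sqr_ge0.
rewrite /weight /reg_sqnorm; set k := \sum_j _.
have k1 : 1 <= k.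
  have [j nj] : exists j, n 0 j != 0.
    apply: contrapT => nh; case/eqP: n0; apply/rowP => j; rewrite mxE.
    by apply/eqP/negPn/negP => nj; apply: nh; exists j.
  rewrite /k (bigD1 j)//=; apply: ler_wpDr.
    by apply: sumr_ge0 => i _; exact: sqr_ge0.
  rewrite -rmorphXn/= -[1]/(1%:~R) ler_int -gtz0_ge1 exprn_even_gt0//.
rewrite -exprVn lerXn2r ?nnegrE ?invr_ge0 ?mulr_ge0//; try lra.
  by rewrite invr_ge0; lra.
rewrite ler_pdivlMr; last by lra.
rewrite mulrC ler_pdivrMr; nra.
Qed.

Lemma hardy_const_ge (A : R) (p : nat) : 1 <= A -> 2 * A ^+ 2 <= p%:R ->
  (8 * 10 ^ (p + l) <= d)%N ->
  (2 * d%:R) ^+ l * ((A - 1) / (A + 1)) ^+ l <= hardy_const R d l.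
Proof.
move=> A1 Ap dp; have [_] := hardy_const_max R l d_gt0; apply => u fu u0.
have dp' : 8 * 10 ^+ (p + l) <= d%:R :> R by rewrite -natrX -natrM ler_nat.
have fRe := fin_supp_Re fu; have fIm := fin_supp_Im fu.
have cRe := renergy_ge A1 Ap dp' (leqnn _) fRe.
have cIm := renergy_ge A1 Ap dp' (leqnn _) fIm.
rewrite energy_split//; apply: le_trans (lerD cRe cIm); rewrite -mulrDr.
have fW f : fin_supp f -> fin_supp (fun n : Zd d => weight A n ^+ l * f n ^+ 2).
  by move=> ff; apply: fin_suppW ff _ => n ->; rewrite expr0n mulr0.
rewrite -zsumD; [|exact: fW..].
have A1p : 0 < A + 1 by lra.
have -> : (2 * d%:R) ^+ l * ((A - 1) / (A + 1)) ^+ l =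
    (2 * d%:R * (A - 1)) ^+ l / (A + 1) ^+ l.
  by rewrite -exprVn -!exprMn mulrA.
rewrite -mulrA ler_wpM2l//.
  by rewrite exprn_ge0// !mulr_ge0// subr_ge0.
rewrite ler_pdivrMl ?exprn_gt0// -zsumZ.
apply: zsum_le => [||n].
- apply: fin_suppU fRe fIm _ => n r0 i0.
  by rewrite cmod_sqr r0 i0 expr0n addr0 mul0r.
- apply: fin_suppU fRe fIm _ => n -> ->.
  by rewrite expr0n !mulr0 addr0 mulr0.
rewrite -mulrDr -cmod_sqr mulrA -exprMn mulrC.
have [->|n0] := eqVneq n 0.
  rewrite u0 (_ : cmod 0 ^+ 2 = 0) ?mulr0//.
  by rewrite cmod_sqr /= expr0n addr0.
by rewrite ler_wpM2r ?sqr_ge0// inv_lattice_norm_le.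
Qed.

End Bounds.

Theorem theorem1 (R : realType) (l : nat) (hl : (0 < l)%N) :
  (fun d : nat => hardy_const R d l / (d%:R : R) ^+ l) @ \oo --> (2 ^+ l : R).
Proof.
apply/cvgrPdist_le => eps eps0.
(* Chosen so that 2^l * l * (2 / (A + 1)) <= eps, where 2 / (A + 1) is the
   defect of t = (A - 1) / (A + 1) from 1. *)
pose A : R := 1 + 2 ^+ l.+1 * l%:R / eps.
have A1 : 1 <= A by rewrite lerDl divr_ge0 ?mulr_ge0 ?exprn_ge0// ltW.
pose p := Num.bound (2 * A ^+ 2).
have Ap : 2 * A ^+ 2 <= p%:R.
  by apply/ltW/archi_boundP; rewrite mulr_ge0 ?sqr_ge0.
pose t : R := (A - 1) / (A + 1).
have tE : t = 1 - 2 / (A + 1) by rewrite /t; field; rewrite gt_eqF//; lra.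
have t0 : 0 <= t by rewrite divr_ge0; lra.
(* Bernoulli's inequality for t = 1 - 2 / (A + 1). *)
have t_ge (k : nat) : 1 - k%:R * (2 / (A + 1)) <= t ^+ k.
  elim: k => [|k IH]; first by rewrite mul0r subr0 expr0.
  rewrite exprS -natr1; have := ler_wpM2l t0 IH.
  have k0 : 0 <= k%:R * (2 / (A + 1)) ^+ 2 by rewrite mulr_ge0 ?sqr_ge0.
  apply: le_trans; move: k0; rewrite tE expr2; nra.
have low : 2 ^+ l * (1 - t ^+ l) <= eps.
  apply: (@le_trans _ _ (2 ^+ l * (l%:R * (2 / (A + 1))))).
    by rewrite ler_wpM2l ?exprn_ge0//; have := t_ge l; lra.
  have -> : 2 ^+ l * (l%:R * (2 / (A + 1))) = 2 ^+ l.+1 * l%:R / (A + 1).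
    by rewrite exprS; ring.
  rewrite ler_pdivrMr; last by lra.
  have -> : 2 ^+ l.+1 * l%:R = eps * (A - 1).
    by rewrite /A; field; rewrite gt_eqF.
  by rewrite ler_wpM2l ?ltW//; lra.
near=> d.
have d0 : (0 < d)%N by near: d; exact: nbhs_infty_gt.
have dp : (8 * 10 ^ (p + l) <= d)%N by near: d; exact: nbhs_infty_ge.
have de : 2 ^+ l * 2 ^+ l / eps <= d%:R by near: d; exact: nbhs_infty_ger.
have D0 : 0 < d%:R :> R by rewrite ltr0n.
have ge := hardy_const_ge d0 A1 Ap dp.
have le := hardy_const_le R l d0.
have Dl : 0 < d%:R ^+ l :> R by rewrite exprn_gt0.
have ge' : 2 ^+ l * t ^+ l <= hardy_const R d l / d%:R ^+ l.
  by rewrite ler_pdivlMr// mulrAC -exprMn.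
have le' : hardy_const R d l / d%:R ^+ l <= 2 ^+ l * (1 + 2 ^+ l / d%:R).
  by rewrite ler_pdivrMr// mulrAC -exprMn.
have up : 2 ^+ l * (2 ^+ l / d%:R) <= eps.
  by rewrite mulrA ler_pdivrMr// [eps * _]mulrC -ler_pdivrMr.
rewrite ler_norml; apply/andP; split; lra.
Unshelve. all: by end_near.
Qed.
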